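(* Let $\Xi\subset\mathbb{R}^n$ be closed and convex, and consider the parametrized discrete-time system $$\xi^+ = \mathbf{P}_{\Xi}\big[f(\xi;\pi)\big],\qquad \xi\in\mathbb{R}^n,$$ where $\pi\in\mathbb{R}^p$ parametrizes the function $f(\cdot\,;\pi):\mathbb{R}^n\to\mathbb{R}^n$. Suppose there exists a continuous function $V:\mathbb{R}^n\to\mathbb{R}_+$ which is radially unbounded and positive definite with respect to a compact set $\mathcal{A}\subset\Xi$ on $\mathbb{R}^n$. Suppose that for some $\epsilon_o\in\mathbb{R}_+$ and for any positive real numbers $\sigma_o$, $\rho_o$ and $b_o$ (with $\sigma_o>\epsilon_o+\rho_o$) there exist a set $P_o\subset\mathbb{R}^p$ and a continuous function $W_{\sigma_o,\epsilon_o}:\mathbb{R}^n\to\mathbb{R}$ such that whenever $\pi\in P_o$: (P1) $W_{\sigma_o,\epsilon_o}(\xi)>0$ for all $\xi\in\Xi\cap\big(\bar{B}_{\sigma_o}(\mathcal{A})\setminus B_{\epsilon_o+\rho_o}(\mathcal{A})\big)$; (P2) $\Delta V(\xi)\leq -W_{\sigma_o,\epsilon_o}(\xi)$ for all $\xi\in\Xi\cap\big(\bar{B}_{\sigma_o}(\mathcal{A})\setminus B_{\epsilon_o+\rho_o}(\mathcal{A})\big)$; and (P3) $\Delta V(\xi)\leq b_o$ for all $\xi\in\Xi\cap\bar{B}_{\epsilon_o+\rho_o}(\mathcal{A})$. Then $\mathcal{A}$ is semiglobally practically asymptotically stable (SPAS) for the system $\xi^+=\mathbf{P}_{\Xi}[f(\xi;\pi)]$,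 with Lyapunov function $V$.
   Context: Notation. $\|\cdot\|$ is the Euclidean norm; $\mathbb{R}_+=[0,\infty)$, $\mathbb{R}_{++}=(0,\infty)$. For a closed set $S\subset\mathbb{R}^n$, $\mathbf{P}_S(x_o)=\arg\min_{x\in S}\|x_o-x\|$ is the orthogonal projection of $x_o\in\mathbb{R}^n$ onto $S$. For a compact set $S\subset\mathbb{R}^n$ and a radius $r$, $\bar{B}_r(S)=\{x\in\mathbb{R}^n:\|x-\mathbf{P}_S(x)\|\le r\}$ and $B_r(S)=\{x\in\mathbb{R}^n:\|x-\mathbf{P}_S(x)\|<r\}$ (so $\|x-\mathbf{P}_S(x)\|$ is the distance from $x$ to $S$). For a sequence $(\xi(t))_{t=0}^\infty$, $\xi$ stands for $\xi(t)$ and $\xi^+$ for $\xi(t+1)$; a trajectory for a given $\pi$ satisfies $\xi(t+1)=\mathbf{P}_{\Xi}[f(\xi(t);\pi)]$ for all $t$. For each $\pi$, $\Delta V(\xi)=V(\xi^+)-V(\xi)=V(\mathbf{P}_{\Xi}[f(\xi;\pi)])-V(\xi)$. A continuous $V:\mathbb{R}^n\to\mathbb{R}_+$ is positive definite with respect to a closed set $S$ on a set $\Omega\supset S$ if $V(S)=\{0\}$ and $V(x)>0$ for all $x\in\Omega\setminus S$. It is radially unbounded with respect to a closed set $S\subset\mathbb{R}^n$ if for any $B\in\mathbb{R}$ there exists $r\in\mathbb{R}_{++}$ such that $V(x)>B$ for all $x\in\mathbb{R}^n\setminus\bar{B}_r(S)$. Definitions (all for the system $\xi^+=\mathbf{P}_{\Xi}[f(\xi;\pi)]$).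 1. A set $\mathcal{A}\subset\Xi$ is practically stable if for some $\check\rho_s\in\mathbb{R}_{++}$, and for any $\rho_s>\check\rho_s$, there exist a positive real number $\delta$ and a set $P_s\subset\mathbb{R}^p$ such that whenever $\pi\in P_s$ and $\xi(0)\in\bar{B}_\delta(\mathcal{A})\cap\Xi$, one has $\xi(t)\in\bar{B}_{\rho_s}(\mathcal{A})\cap\Xi$ for all $t\in\mathbb{N}$. 2. A compact set $S\subset\mathbb{R}^n$ is uniformly attractive (for the system with a given $\pi$) on a compact set $\Omega\subset\mathbb{R}^n$ if for every $\varepsilon\in\mathbb{R}_{++}$ for which $\bar{B}_\varepsilon(S)\cap\Xi\subset\Omega\cap\Xi$, there exists a number $T\in\mathbb{N}$ such that $\xi(t)\in\bar{B}_\varepsilon(S)$ whenever $\xi(0)\in\Omega$ and $t\ge T$. 3. A compact set $\mathcal{A}\subset\Xi$ is semiglobally, practically attractive if for some $\check\rho_a\in\mathbb{R}_{++}$, and for any $\sigma,\rho_a\in\mathbb{R}_{++}$ with $\sigma>\rho_a>\check\rho_a$, there exists a set $P_a\subset\mathbb{R}^p$ such that whenever $\pi\in P_a$, the set $\bar{B}_{\rho_a}(\mathcal{A})$ is uniformly attractive on $\bar{B}_\sigma(\mathcal{A})$. 4. A set $\mathcal{A}\subset\Xi$ is semiglobally practically asymptotically stable (SPAS) if it is practically stable and semiglobally, practically attractive. (The numbers $\check\rho_s$ and $\check\rho_a$ need not coincide, nor do the sets $P_s$ and $P_a$.) ''Lyapunov function $V$'' refers to the function $V$ in the hypotheses.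
   Formalization: The parameter sets P_o, P_s, P_a are required to be nonempty (otherwise SPAS is vacuous), and in uniform attractivity the initial state is taken in Ω∩Ξ instead of Ω, since the claim fails for initial states outside Ξ, where P1–P3 do not constrain f. *)

(* Defs.v *)
From HB Require Import structures.
From mathcomp Require Import all_boot all_order all_algebra.
From mathcomp Require Import all_classical all_reals all_analysis.

Set Implicit Arguments.
Unset Strict Implicit.
Unset Printing Implicit Defensive.

Import Order.TTheory GRing.Theory Num.Theory.
Import numFieldNormedType.Exports.

Local Open Scope classical_set_scope.
Local Open Scope ring_scope.

(* The library norm `|x| on row vectors is the sup norm, hence this separate
   Euclidean norm. Both induce the same topology, so the library's [continuous],
   [closed] and [compact] are the usual notions on R^n. *)
Definition enorm (R : realType) (n : nat) (x : 'rV[R]_n) : R :=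
  Num.sqrt (\sum_(i < n) x ord0 i ^+ 2).

Definition nearest_points (R : realType) (n : nat) (S : set 'rV[R]_n)
    (x : 'rV[R]_n) : set 'rV[R]_n :=
  [set y | S y /\ forall z, S z -> enorm (x - y) <= enorm (x - z)].

(* A chosen nearest point. It exists when S is closed and nonempty, and is the
   only one when S is moreover convex. For a nonconvex S the choice does not
   affect enorm (x - eproj S x), the distance from x to S. The default value x
   is used only if there is no nearest point. *)
Definition eproj (R : realType) (n : nat) (S : set 'rV[R]_n) (x : 'rV[R]_n) :
    'rV[R]_n :=
  xget x (nearest_points S x).

Definition cnbhd (R : realType) (n : nat) (r : R) (S : set 'rV[R]_n) :
    set 'rV[R]_n :=
  [set x | enorm (x - eproj S x) <= r].

Definition onbhd (R : realType) (n : nat) (r : R) (S : set 'rV[R]_n) :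
    set 'rV[R]_n :=
  [set x | enorm (x - eproj S x) < r].

(* V @` S = [set 0] is an equality of sets, so it forces S to be nonempty. *)
Definition positive_definite_wrt (R : realType) (n : nat) (V : 'rV[R]_n -> R)
    (S Omega : set 'rV[R]_n) : Prop :=
  [/\ closed S, S `<=` Omega, V @` S = [set 0]
    & forall x, (Omega `\` S) x -> 0 < V x].

Definition radially_unbounded_wrt (R : realType) (n : nat) (V : 'rV[R]_n -> R)
    (S : set 'rV[R]_n) : Prop :=
  closed S /\
  forall B : R, exists2 r : R, 0 < r & forall x, (~` cnbhd r S) x -> B < V x.

Section System.
Variables (R : realType) (n p : nat).
Variables (Xi : set 'rV[R]_n) (f : 'rV[R]_p -> 'rV[R]_n -> 'rV[R]_n).

Definition trajectory (pi : 'rV[R]_p) (xi : nat -> 'rV[R]_n) : Prop :=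
  forall t, xi t.+1 = eproj Xi (f pi (xi t)).

Definition DeltaV (V : 'rV[R]_n -> R) (pi : 'rV[R]_p) (x : 'rV[R]_n) : R :=
  V (eproj Xi (f pi x)) - V x.

(* The set of admissible parameters is required to be nonempty, here and in
   [semiglobally_practically_attractive]: with P = set0 every set would have
   the property. *)
Definition practically_stable (A : set 'rV[R]_n) : Prop :=
  A `<=` Xi /\
  exists2 rhos0 : R, 0 < rhos0 &
    forall rhos : R, rhos0 < rhos ->
    exists (delta : R) (P : set 'rV[R]_p),
      [/\ 0 < delta, P !=set0 &
        forall pi, P pi ->
        forall xi, trajectory pi xi -> (cnbhd delta A `&` Xi) (xi 0%N) ->
        forall t, (cnbhd rhos A `&` Xi) (xi t)].

(* Initial states are taken in Xi, as in [practically_stable]: Xi is the state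
   space, and f is unconstrained outside it. *)
Definition uniformly_attractive (pi : 'rV[R]_p) (S Omega : set 'rV[R]_n) :
    Prop :=
  [/\ compact S, compact Omega &
    forall eps : R, 0 < eps -> cnbhd eps S `&` Xi `<=` Omega `&` Xi ->
    exists T : nat,
      forall xi, trajectory pi xi -> (Omega `&` Xi) (xi 0%N) ->
      forall t, (T <= t)%N -> cnbhd eps S (xi t)].

Definition semiglobally_practically_attractive (A : set 'rV[R]_n) : Prop :=
  [/\ compact A, A `<=` Xi &
    exists2 rhoa0 : R, 0 < rhoa0 &
      forall sigma rhoa : R, 0 < sigma -> 0 < rhoa ->
        rhoa < sigma -> rhoa0 < rhoa ->
      exists2 P : set 'rV[R]_p, P !=set0 &
        forall pi, P pi -> uniformly_attractive pi (cnbhd rhoa A) (cnbhd sigma A)].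

Definition SPAS (A : set 'rV[R]_n) : Prop :=
  practically_stable A /\ semiglobally_practically_attractive A.

End System.

(* Main.v *)
Require Import Defs.
From HB Require Import structures.
From mathcomp Require Import all_boot all_order all_algebra.
From mathcomp Require Import all_classical all_reals all_analysis.
From mathcomp Require Import lra.

Set Implicit Arguments.
Unset Strict Implicit.
Unset Printing Implicit Defensive.

Import Order.TTheory GRing.Theory Num.Theory.
Import numFieldNormedType.Exports.

Local Open Scope classical_set_scope.
Local Open Scope ring_scope.

(** Let [m] be [1] plus the maximum of [V] on the core, the [eps + 1]-neighborhood
    of [A].  With [rho = b = 1], a step from the core lands in [{V <= m}] and a
    step from outside the core decreases [V], so every sublevel set [{V <= c}]
    with [m <= c] is invariant as long as it lies in the [sigma]-neighborhood on
    which (P1)-(P2) hold; radial unboundedness provides such a [sigma].  The same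
    radius [r] containing [{V <= m}] serves as threshold for both stability and
    attractivity.  For attractivity, choose [c] to bound [V] on the set of initial
    states: by compactness [V] decreases by a uniform amount at each step outside
    the core, so the core is visited in bounded time, after which the trajectory
    stays in [{V <= m}]. *)

Section Euclidean.
Variables (R : realType) (n : nat).
Implicit Types (x y a : 'rV[R]_n) (S : set 'rV[R]_n) (r : R).

Lemma enorm_continuous : continuous (@enorm R n).
Proof.
move=> x; apply: (@continuous_comp _ _ _
  (fun y : 'rV[R]_n => \sum_(i < n) y ord0 i ^+ 2) (@Num.sqrt R)).
  apply: continuous_big => [|i _]; first exact: add_continuous.
  move=> y; apply: (@continuous_comp _ _ _
    (fun z : 'rV[R]_n => z ord0 i) (fun u : R => u ^+ 2)).
    exact: coord_continuous.
  exact: exprn_continuous.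
exact: sqrt_continuous.
Qed.

Lemma enorm0 : enorm (0 : 'rV[R]_n) = 0.
Proof.
rewrite /enorm big1 ?sqrtr0// => i _.
by rewrite mxE expr0n.
Qed.

Lemma normr_coord_le_enorm x i : `|x ord0 i| <= enorm x.
Proof.
rewrite -sqrtr_sqr ler_wsqrtr// (bigD1 i)//= lerDl.
by apply: sumr_ge0 => j _; exact: sqr_ge0.
Qed.

Lemma enorm_subr_continuous a : continuous (fun y => enorm (a - y)).
Proof.
move=> y; apply: (@continuous_comp _ _ _
    (fun z : 'rV[R]_n => a - z) (@enorm R n)).
  by apply: continuousB => //; exact: cst_continuous.
exact: enorm_continuous.
Qed.

Lemma enorm_subl_continuous a : continuous (fun y => enorm (y - a)).
Proof.
move=> y; apply: (@continuous_comp _ _ _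
    (fun z : 'rV[R]_n => z - a) (@enorm R n)).
  by apply: continuousB => //; exact: cst_continuous.
exact: enorm_continuous.
Qed.

(** Each coordinate is bounded by the Euclidean norm, so the ball is a closed subset of a product of
    segments. *)
Lemma compact_enorm_ball a r : compact [set y | enorm (a - y) <= r].
Proof.
have box : compact [set y : 'rV[R]_n |
    forall i, `[a ord0 i - r, a ord0 i + r]%classic (y ord0 i)].
  by apply: (@rV_compact _ _
    (fun i => `[a ord0 i - r, a ord0 i + r]%classic)) => i;
    exact: segment_compact.
apply: subclosed_compact box _.
  have /continuous_closedP cl := @enorm_subr_continuous a.
  exact: (cl _ (@closed_le R r)).
move=> y /= ayr i; have := le_trans (normr_coord_le_enorm (a - y) i) ayr.
rewrite !mxE /= in_itv/= ler_norml => /andP[? ?].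
by apply/andP; split; lra.
Qed.

(** Minimizing over the points of [S] at least as close to [x] as some fixed [z] in [S] suffices:
    these form a compact set, and all others are farther away than [z]. *)
Lemma eproj_nearest S x : closed S -> S !=set0 -> nearest_points S x (eproj S x).
Proof.
move=> clS [z Sz]; apply: xgetPex.
have cK : compact ([set y | enorm (x - y) <= enorm (x - z)] `&` S).
  by apply: compact_closedI clS; exact: compact_enorm_ball.
have [|y yK ymin] := EVT_min_rV _ cK
    (continuous_subspaceT (@enorm_subr_continuous x)).
  by exists z; split => /=.
exists y; move: yK; rewrite inE => -[/= yz Sy]; split => // u Su.
have [uz|zu] := leP (enorm (x - u)) (enorm (x - z)).
  by apply: ymin; rewrite inE.
exact: le_trans yz (ltW zu).
Qed.

Lemma eproj_in S x : closed S -> S !=set0 -> S (eproj S x).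
Proof. by move=> clS S0; have [] := eproj_nearest x clS S0. Qed.

Lemma cnbhd_near S r x y : closed S -> S y -> enorm (x - y) <= r -> cnbhd r S x.
Proof.
move=> clS Sy xyr.
have [|_ /(_ _ Sy) xy] := @eproj_nearest S x clS; first by exists y.
exact: le_trans xy xyr.
Qed.

Lemma sub_cnbhd S r : closed S -> 0 <= r -> S `<=` cnbhd r S.
Proof.
by move=> clS r0 x Sx; apply: (cnbhd_near clS Sx); rewrite subrr enorm0.
Qed.

Lemma le_cnbhd S (r s : R) : r <= s -> cnbhd r S `<=` cnbhd s S.
Proof. by move=> rs x /le_trans; exact. Qed.

(** Subtraction maps the compact product of [S] and a closed ball onto the neighborhood, since [x]
    is [eproj S x] minus a vector of norm at most [r]. *)
Lemma compact_cnbhd S r : compact S -> S !=set0 -> compact (cnbhd r S).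
Proof.
move=> cS S0; have clS : closed S by exact: compact_closed cS.
have -> : cnbhd r S =
    (fun p : 'rV[R]_n * 'rV[R]_n => p.1 - p.2) @`
      (S `*` [set y | enorm (0 - y) <= r]).
  apply/seteqP; split=> [x xr|_ [[a y] [/= Sa yr] <-]].
    exists (eproj S x, eproj S x - x) => /=; last by rewrite opprB addrC subrK.
    by split => /=; [exact: eproj_in|rewrite sub0r opprB].
  by apply: (cnbhd_near clS Sa); rewrite addrAC subrr.
apply: continuous_compact.
  by apply: continuous_subspaceT => p; exact: sub_continuous.
by apply: compact_setX cS _; exact: compact_enorm_ball.
Qed.

Lemma open_onbhd S r : closed S -> S !=set0 -> open (onbhd r S).
Proof.
move=> clS S0.
have -> : onbhd r S = \bigcup_(a in S) [set x | enorm (x - a) < r].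
  apply/seteqP; split=> [x xr|x [a Sa /= xar]].
    by exists (eproj S x) => //; exact: eproj_in.
  have [_ /(_ _ Sa) xa] := eproj_nearest x clS S0.
  exact: le_lt_trans xa xar.
apply: bigcup_open => a _.
have /continuousP op := @enorm_subl_continuous a.
exact: (op _ (@open_lt R r)).
Qed.

End Euclidean.

Section Compact.
Variables (T : topologicalType) (R : realType) (K : set T) (g : T -> R).
Hypotheses (cK : compact K) (cg : continuous g).

Lemma compact_ubound : exists M, forall x, K x -> g x <= M.
Proof.
have [K0|/set0P K0] := eqVneq K set0; first by exists 0 => x; rewrite K0.
have [c _ cmax] := compact_EVT_max K0 cK (continuous_subspaceT cg).
by exists (g c) => x Kx; apply: cmax; rewrite inE.
Qed.

Lemma compact_pos_lbound : (forall x, K x -> 0 < g x) ->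
  exists2 w, 0 < w & forall x, K x -> w <= g x.
Proof.
move=> gpos.
have [K0|/set0P K0] := eqVneq K set0; first by exists 1 => // x; rewrite K0.
have [c] := compact_EVT_min K0 cK (continuous_subspaceT cg).
rewrite inE => Kc cmin.
by exists (g c); [exact: gpos|move=> x Kx; apply: cmin; rewrite inE].
Qed.

End Compact.

Section Descent.
Variables (T : Type) (R : realType) (V : T -> R) (D : set T) (x : nat -> T).
Variables (m c w : R).
Hypothesis le_mc : m <= c.
Hypothesis step_in : forall t, D (x t) -> V (x t.+1) <= m.
Hypothesis step_out : forall t, V (x t) <= c -> ~ D (x t) ->
  V (x t.+1) <= V (x t) - w.

(** By induction, a step from [D] lands below [m <= b], and any other step does not raise [V];
    [b <= c] keeps [step_out] applicable. *)
Lemma descent_invariant (b : R) s : 0 <= w -> m <= b -> b <= c ->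
  V (x s) <= b -> forall t, (s <= t)%N -> V (x t) <= b.
Proof.
move=> w0 mb bc Vs t /subnKC <-; elim: (t - s)%N => [|k IH].
  by rewrite addn0.
rewrite addnS; have [Dk|nDk] := pselect (D (x (s + k)%N)).
  exact: le_trans (step_in Dk) mb.
by have := step_out (le_trans IH bc) nDk; lra.
Qed.

(** Missing [D] at all of the first [N] times would cost at least [w * N > c] and make [V] negative.
    So [D] is visited before time [N]. *)
Lemma descent_attractive (N : nat) : 0 < w -> (forall t, 0 <= V (x t)) ->
  V (x 0%N) <= c -> c < w * N%:R -> forall t, (N <= t)%N -> V (x t) <= m.
Proof.
move=> w0 V0 Vx0 cN t Nt.
have [[s sN Ds]|noD] := pselect (exists2 s, (s < N)%N & D (x s)).
  (* The bound [m] holds only from the step after the visit, hence [s.+1], which is still at most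
     [N]. *)
  apply: (@descent_invariant m s.+1) => //; [exact: ltW|exact: step_in|].
  exact: leq_trans sN Nt.
have Vc s : V (x s) <= c by apply: (@descent_invariant c 0%N) => //; exact: ltW.
have Vs s : (s <= N)%N -> V (x s) <= c - w * s%:R.
  elim: s => [_|s IH sN]; first by rewrite mulr0 subr0.
  have nDs : ~ D (x s) by move=> Ds; apply: noD; exists s.
  have := step_out (Vc s) nDs; have := IH (ltnW sN).
  by rewrite -natr1 mulrDr mulr1; lra.
by have := Vs N (leqnn N); have := V0 N; lra.
Qed.

End Descent.

Theorem mainTheorem1 (R : realType) (n p : nat)
  (Xi : set 'rV[R]_n) (Xi_closed : closed Xi) (Xi_convex : convex_set Xi)
  (f : 'rV[R]_p -> 'rV[R]_n -> 'rV[R]_n)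
  (A : set 'rV[R]_n) (A_compact : compact A) (A_sub : A `<=` Xi)
  (V : 'rV[R]_n -> R) (V_cont : continuous V) (V_ge0 : forall x, 0 <= V x)
  (V_unbounded : radially_unbounded_wrt V A)
  (V_posdef : positive_definite_wrt V A setT)
  (eps : R) (eps_ge0 : 0 <= eps)
  (hP : forall sigma rho b : R, 0 < sigma -> 0 < rho -> 0 < b ->
    eps + rho < sigma ->
    exists (P : set 'rV[R]_p) (W : 'rV[R]_n -> R),
      [/\ P !=set0, continuous W &
        forall pi, P pi ->
        [/\ forall x,
              (Xi `&` (cnbhd sigma A `\` onbhd (eps + rho) A)) x -> 0 < W x,
            forall x,
              (Xi `&` (cnbhd sigma A `\` onbhd (eps + rho) A)) x ->
              DeltaV Xi f V pi x <= - W x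
          & forall x,
              (Xi `&` cnbhd (eps + rho) A) x -> DeltaV Xi f V pi x <= b]]) :
  SPAS Xi f A.
Proof.
have [A_closed _ VA _] := V_posdef.
have [a Aa] : A !=set0.
  by have : [set 0] (0 : R) by []; rewrite -VA => -[a Aa _]; exists a.
have A0 : A !=set0 by exists a.
have Xi0 : Xi !=set0 by exists a; exact: A_sub.
have [_ V_unb] := V_unbounded.
have [M VM] := compact_ubound (@compact_cnbhd _ _ _ (eps + 1) A_compact A0) V_cont.
have sublevel_cnbhd c : exists2 r, 0 < r & forall x, V x <= c -> cnbhd r A x.
  have [r r0 rc] := V_unb c; exists r => // x Vxc.
  by apply: contrapT => /rc; rewrite ltNge Vxc.
have [r r0 Mr] := sublevel_cnbhd (M + 1).
have traj_Xi pi xi : trajectory Xi f pi xi -> Xi (xi 0%N) -> forall t, Xi (xi t).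
  by move=> tr xi0 [//|t]; rewrite tr; exact: eproj_in.
(* On [{V <= c}] the drop of [V] outside the core is uniform. *)
have control c : exists2 P : set 'rV[R]_p, P !=set0 & forall pi, P pi ->
    exists2 w, 0 < w & forall xi, trajectory Xi f pi xi -> Xi (xi 0%N) ->
      (forall t, cnbhd (eps + 1) A (xi t) -> V (xi t.+1) <= M + 1) /\
      (forall t, V (xi t) <= c -> ~ cnbhd (eps + 1) A (xi t) ->
        V (xi t.+1) <= V (xi t) - w).
  have [s s0 cs] := sublevel_cnbhd c.
  (* The radius [s + eps + 2] exceeds both [s], so that it covers [{V <= c}], and [eps + 1], as the
     hypothesis demands. *)
  have [||||P [W [P0 Wc PW]]] := hP (s + eps + 2) 1 1; [lra..|].
  exists P => // pi /PW[Wpos VW Vb].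
  have cK : compact (cnbhd (s + eps + 2) A `&`
      (Xi `&` ~` onbhd (eps + 1) A)).
    apply: compact_closedI; first exact: compact_cnbhd.
    by apply: closedI => //; apply: open_closedC; exact: open_onbhd.
  have [|w w0 wW] := compact_pos_lbound cK Wc.
    by move=> x [? [? ?]]; exact: Wpos.
  exists w => // xi tr xi0; have xiXi := traj_Xi _ _ tr xi0.
  split=> t; rewrite tr => Ht.
    by have := Vb _ (conj (xiXi t) Ht); have := VM _ Ht; rewrite /DeltaV; lra.
  move=> nD.
  have xs : cnbhd (s + eps + 2) A (xi t).
    by apply: le_cnbhd (cs _ Ht); lra.
  (* The region of (P1)-(P2) includes the boundary of the core, so leaving the closed neighborhood
     is more than enough. *)
  have xo : ~ onbhd (eps + 1) A (xi t) by move=> /ltW.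
  have := VW _ (conj (xiXi t) (conj xs xo)).
  have := wW _ (conj xs (conj (xiXi t) xo)).
  by rewrite /DeltaV; lra.
split.
  split=> //; exists r => // rhos r_rhos.
  have [P P0 HP] := control (M + 1).
  (* Initial states are taken in the core itself, where [V <= M]. *)
  exists (eps + 1), P; split => //; first lra.
  move=> pi /HP[w w0 Hw] xi tr [xi0 xi0Xi] t.
  have [hin hout] := Hw xi tr xi0Xi; split; last exact: (traj_Xi pi).
  apply: le_cnbhd (ltW r_rhos) _ _; apply: Mr.
  apply: (descent_invariant hin hout (ltW w0) (lexx _) (lexx _) _ (leq0n t)).
  by have := VM _ xi0; lra.
split=> //; exists r => // sigma rhoa sigma0 rhoa0 _ r_rhoa.
have c_sigma := @compact_cnbhd _ _ _ sigma A_compact A0.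
have c_rhoa := @compact_cnbhd _ _ _ rhoa A_compact A0.
have [M' VM'] := compact_ubound c_sigma V_cont.
(* The level must dominate [V] on all initial states and also [M + 1], for descent to apply. *)
pose c := Num.max (M + 1) M'.
have [P P0 HP] := control c.
exists P => // pi /HP[w w0 Hw]; split=> // e e0 _.
have [N cN] : exists N : nat, c < w * N%:R.
  exists (Num.truncn (c / w)).+1; rewrite mulrC -ltr_pdivrMr//.
  exact: truncnS_gt.
exists N => xi tr [xi0 xi0Xi] t Nt.
have [hin hout] := Hw xi tr xi0Xi.
(* The trajectory even ends up in [cnbhd rhoa A], so any [e > 0] works with the same [N]. *)
apply: sub_cnbhd (ltW e0) _ _; first exact: compact_closed c_rhoa.
apply: le_cnbhd (ltW r_rhoa) _ _; apply: Mr.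
apply: (descent_attractive _ hin hout w0 _ _ cN Nt) => //.
  by rewrite le_max lexx.
by rewrite le_max (VM' _ xi0) orbT.
Qed.
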